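(* Let $\pi=a_1a_2\cdots a_n$ be a full permutation of $[n]$ with $n\ge 2$, and let $M$ be the top-level meld produced by left bracketing of $\pi$. If $M$ has the form $[m_1,m_2]$, then $\pi$ is indecomposable (so $\pi=\pi_1$ is its only indecomposable component). Otherwise $\pi$ is decomposable, $M$ has the form $(m_1,m_2)$, and $m_2$ is the rightmost indecomposable component $\pi_q$ of $\pi$ (i.e. the word formed by the entries of $m_2$ in order is $\pi_q$), with $m_2$ being its left bracketing.
   Context: $[n]=\{1,\dots,n\}$; one-line notation. The permutation matrix of $\pi$ has a $1$ in row $n+1-a_j$, column $j$. Bootstrap percolation: a cell is mutable if it contains $0$ and at least two orthogonal neighbours contain $1$; mutable cells are changed to $1$ one at a time until none remain (final configuration independent of order); $\pi$ is full if the final configuration is the all-ones matrix. A permutation of $[k]$ is indecomposable if it maps no proper initial segment $\{1,\dots,j\}$, $1\le j<k$, onto itself; a word of distinct integers is indecomposable if its reduced form (replace the $i$-th smallest entry by $i$) is. Indecomposable components: $\pi=\pi_1\cdots\pi_q$ (concatenation) where $\pi_1$ is the longest indecomposable prefix of $\pi$ and the remaining components are obtained recursively from the rest of the word. Melds: each $a_j$ (at position $j$) is a meld with entry set $\{a_j\}$; melds $m_1,m_2$ occupying adjacent position intervals, $m_1$ left of $m_2$, with entry sets $E_1,E_2$ whose union is a set of consecutive integers, are mergeable, with merger $(m_1,m_2)$ if $\max E_1+1=\min E_2$ and $[m_1,m_2]$ if $\min E_1=\max E_2+1$. Left bracketing: start from singleton melds $a_1,\dots,a_n$ and repeatedly merge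 the leftmost adjacent mergeable pair until none remains; for a full $\pi$ with $n\ge2$ it ends in a single meld $M$ of the form $(m_1,m_2)$ or $[m_1,m_2]$ (the top-level left bracketing). The left bracketing of a word of distinct integers is defined in the same way. *)

(* Defs.v *)
From mathcomp Require Import all_boot all_fingroup all_algebra.

Set Implicit Arguments.
Unset Strict Implicit.
Unset Printing Implicit Defensive.

Local Open Scope nat_scope.

(* One-line notation a_1 ... a_n, where a_j = (p (j-1)) + 1 ('I_n is 0-based). *)
Definition one_line (n : nat) (p : 'S_n) : seq nat :=
  [seq (val (p j)).+1 | j <- enum 'I_n].

Section Bootstrap.
Variable n : nat.

(* Row n + 1 - a_j in 1-based indexing is row n - 1 - p j = rev_ord (p j) in
   0-based indexing. *)
Definition percolation_mx (p : 'S_n) : 'M[bool]_n :=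
  \matrix_(i, j) (i == rev_ord (p j)).

Definition orth_neighbour (c d : 'I_n * 'I_n) : bool :=
  ((c.1 == d.1) && ((c.2.+1 == d.2 :> nat) || (d.2.+1 == c.2 :> nat)))
  || ((c.2 == d.2) && ((c.1.+1 == d.1 :> nat) || (d.1.+1 == c.1 :> nat))).

Definition mutable (A : 'M[bool]_n) (c : 'I_n * 'I_n) : bool :=
  ~~ A c.1 c.2 && (2 <= #|[set d | orth_neighbour c d && A d.1 d.2]|).

Definition mutate (A : 'M[bool]_n) (c : 'I_n * 'I_n) : 'M[bool]_n :=
  \matrix_(i, j) (((i, j) == c) || A i j).

Definition bootstrap_step : rel 'M[bool]_n :=
  fun A B => [exists c, mutable A c && (B == mutate A c)].

Definition final_config (A B : 'M[bool]_n) : bool :=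
  connect bootstrap_step A B && [forall c, ~~ mutable B c].

Definition full (p : 'S_n) : bool :=
  final_config (percolation_mx p) (const_mx true).

End Bootstrap.

(* [s] is the one-line notation of a permutation of {1, ..., size s}; its first
   j entries are the image of {1, ..., j}. *)
Definition indecomposable_perm (s : seq nat) : bool :=
  all (fun j => ~~ perm_eq (take j s) (iota 1 j)) (iota 1 (size s).-1).

Definition reduced_form (w : seq nat) : seq nat :=
  [seq (index x (sort leq w)).+1 | x <- w].

Definition indecomposable (w : seq nat) : bool :=
  indecomposable_perm (reduced_form w).

Definition longest_indec_prefix_size (w : seq nat) : nat :=
  foldr maxn 0 [seq k <- iota 1 (size w) | indecomposable (take k w)].

(* A one-letter prefix is indecomposable, so each component of a nonempty word
   is nonempty and [size w] rounds exhaust [w]. *)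
Fixpoint components_rec (fuel : nat) (w : seq nat) : seq (seq nat) :=
  match fuel, w with
  | fuel'.+1, _ :: _ =>
      let k := longest_indec_prefix_size w in
      take k w :: components_rec fuel' (drop k w)
  | _, _ => [::]
  end.

Definition components (w : seq nat) : seq (seq nat) :=
  components_rec (size w) w.

(* [Inc m1 m2] is the meld (m1, m2) and [Dec m1 m2] is the meld [m1, m2]. *)
Inductive meld : Type :=
| Single of nat
| Inc of meld & meld
| Dec of meld & meld.

Fixpoint entries (m : meld) : seq nat :=
  match m with
  | Single a => [:: a]
  | Inc m1 m2 | Dec m1 m2 => entries m1 ++ entries m2
  end.

Definition seq_max (s : seq nat) : nat := foldr maxn 0 s.
Definition seq_min (s : seq nat) : nat := foldr minn (head 0 s) s.

Definition consecutive (s : seq nat) : bool :=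
  all (mem s) (iota (seq_min s) (seq_max s - seq_min s).+1).

(* The merger of two melds occupying adjacent position intervals, [m1] on the
   left, or [None] if they are not mergeable. *)
Definition merge_melds (m1 m2 : meld) : option meld :=
  if ~~ consecutive (entries m1 ++ entries m2) then None
  else if (seq_max (entries m1)).+1 == seq_min (entries m2) then
    Some (Inc m1 m2)
  else if seq_min (entries m1) == (seq_max (entries m2)).+1 then
    Some (Dec m1 m2)
  else None.

(* A list of melds is in position order, so neighbours in the list are exactly
   the melds occupying adjacent position intervals. *)
Fixpoint merge_leftmost (ms : seq meld) : option (seq meld) :=
  match ms with
  | m1 :: ((m2 :: ms') as t) =>
      if merge_melds m1 m2 is Some m then Some (m :: ms')
      else omap (cons m1) (merge_leftmost t)
  | _ => None
  end.

(* A merge shortens the list by one, so no mergeable pair remains after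
   [size w] rounds. *)
Definition left_bracketing (w : seq nat) : seq meld :=
  iter (size w) (fun ms => odflt ms (merge_leftmost ms)) (map Single w).

(* Main.v *)
(* Each meld of left bracketing covers a block of consecutive positions and
   consecutive values.  When no two adjacent melds are mergeable, no two blocks
   touch, so their union is closed under percolation; hence for a full
   permutation a single meld M remains.  If M is a Dec, the maximum n precedes
   the minimum 1, with n in the first block and 1 in the second, so no proper
   prefix is an initial segment.  If M = Inc m1 m2, left bracketing has worked
   on the letters of m2 alone since m1 was completed, hence m2 is their left
   bracketing.  Moreover m2 is not an Inc a b, since then m1 would have been
   merged with a; so the word of m2 is a letter or comes from a Dec, and is
   indecomposable. *)

Require Import Defs.
From mathcomp Require Import all_boot all_fingroup all_algebra.
From mathcomp Require Import zify.

Set Implicit Arguments.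
Unset Strict Implicit.
Unset Printing Implicit Defensive.

Local Open Scope nat_scope.

(** * Words whose values form an interval *)

Definition interval (lo : nat) (s : seq nat) : bool :=
  perm_eq s (iota lo (size s)).

Lemma mem_interval lo s x :
  interval lo s -> (x \in s) = (lo <= x < lo + size s).
Proof. by move=> /perm_mem->; rewrite mem_iota. Qed.

Lemma interval_uniq lo s : interval lo s -> uniq s.
Proof. by move=> /perm_uniq->; apply: iota_uniq. Qed.

Lemma interval_cat lo s t :
  interval lo s -> interval (lo + size s) t -> interval lo (s ++ t).
Proof. by move=> hs ht; rewrite /interval size_cat iotaD perm_cat. Qed.

Lemma interval_catC lo s t :
  interval lo (s ++ t) -> interval lo (t ++ s).
Proof. by rewrite /interval perm_catC !size_cat addnC. Qed.

Lemma interval_lo lo lo' s :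
  0 < size s -> interval lo s -> interval lo' s -> lo = lo'.
Proof.
move=> s0 h h'.
have e x : (lo <= x < lo + size s) = (lo' <= x < lo' + size s).
  by rewrite -(mem_interval _ h) (mem_interval _ h').
by have := e lo; have := e lo'; lia.
Qed.

Lemma interval_suffix lo s t :
  interval lo (s ++ t) -> interval lo s -> interval (lo + size s) t.
Proof.
rewrite /interval size_cat iotaD => h hs.
by rewrite -(perm_cat2l s) (perm_trans h) // perm_cat2r perm_sym.
Qed.

Lemma seq_maxP s x :
  x \in s -> (forall y, y \in s -> y <= x) -> seq_max s = x.
Proof.
move=> xs ub; apply/eqP; rewrite eqn_leq; apply/andP; split.
  elim: s ub {xs} => //= a s ih ub.
  rewrite geq_max ub ?mem_head // ih // => y ys.
  by apply: ub; rewrite inE ys orbT.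
elim: s xs {ub} => //= a s ih; rewrite inE => /orP[/eqP->|/ih h].
  exact: leq_maxl.
by rewrite leq_max h orbT.
Qed.

Lemma seq_minP s x :
  x \in s -> (forall y, y \in s -> x <= y) -> seq_min s = x.
Proof.
case: s => // b s xs lb; rewrite /seq_min [head _ _]/=.
have bx : x <= b by apply: lb; rewrite mem_head.
apply/eqP; rewrite eqn_leq; apply/andP; split.
  elim: (b :: s) xs {lb} => //= a t ih; rewrite inE => /orP[/eqP->|/ih h].
    exact: geq_minl.
  by rewrite geq_min h orbT.
elim: (b :: s) lb {xs} => //= a t ih lb.
rewrite leq_min lb ?mem_head // ih // => y yt.
by apply: lb; rewrite inE yt orbT.
Qed.

Lemma seq_max_interval lo s :
  0 < size s -> interval lo s -> (seq_max s).+1 = lo + size s.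
Proof.
move=> s0 h; rewrite (@seq_maxP _ (lo + (size s).-1)); first lia.
  by rewrite (mem_interval _ h); lia.
by move=> y; rewrite (mem_interval _ h); lia.
Qed.

Lemma seq_min_interval lo s : 0 < size s -> interval lo s -> seq_min s = lo.
Proof.
move=> s0 h; rewrite (@seq_minP _ lo) //.
  by rewrite (mem_interval _ h); lia.
by move=> y; rewrite (mem_interval _ h); lia.
Qed.

Lemma consecutive_interval lo s :
  0 < size s -> interval lo s -> consecutive s.
Proof.
move=> s0 h; apply/allP => x; rewrite mem_iota inE (mem_interval _ h).
have := seq_max_interval s0 h; rewrite (seq_min_interval s0 h); lia.
Qed.

(** * Melds over adjacent value intervals *)

Lemma size_entries m : 0 < size (entries m).
Proof. by elim: m => //= a ha b hb; rewrite size_cat addn_gt0 ha. Qed.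

(** Keeping the value intervals of the children reduces the tests of [merge_melds] to arithmetic on
    interval bounds. *)
Fixpoint well_formed (m : meld) : Prop :=
  match m with
  | Single _ => True
  | Inc a b => [/\ well_formed a, well_formed b & exists2 lo,
      interval lo (entries a) & interval (lo + size (entries a)) (entries b)]
  | Dec a b => [/\ well_formed a, well_formed b & exists2 lo,
      interval lo (entries b) & interval (lo + size (entries b)) (entries a)]
  end.

Lemma well_formed_interval m :
  well_formed m -> exists lo, interval lo (entries m).
Proof.
case: m => [a _|a b [_ _ [lo ha hb]]|a b [_ _ [lo hb ha]]] /=; exists lo || exists a.
- by rewrite /interval.
- exact: interval_cat.
- by apply: interval_catC; apply: interval_cat.
Qed.

Lemma merge_inc x y lo :
  interval lo (entries x) -> interval (lo + size (entries x)) (entries y) ->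
  merge_melds x y = Some (Inc x y).
Proof.
move=> hx hy; have sx := size_entries x; have sy := size_entries y.
rewrite /merge_melds (consecutive_interval _ (interval_cat hx hy)) /=.
  by rewrite (seq_max_interval sx hx) (seq_min_interval sy hy) eqxx.
by rewrite size_cat addn_gt0 sx.
Qed.

Lemma merge_dec x y lo :
  interval lo (entries y) -> interval (lo + size (entries y)) (entries x) ->
  merge_melds x y = Some (Dec x y).
Proof.
move=> hy hx; have sx := size_entries x; have sy := size_entries y.
have hxy := interval_catC (interval_cat hy hx).
rewrite /merge_melds (consecutive_interval _ hxy) /=; last first.
  by rewrite size_cat addn_gt0 sx.
rewrite (seq_max_interval sx hx) (seq_min_interval sy hy).
rewrite (seq_max_interval sy hy) (seq_min_interval sx hx) eqxx.
by case: eqP => //; lia.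
Qed.

Lemma merge_meldsP x y m :
  merge_melds x y = Some m ->
  (m = Inc x y /\ (seq_max (entries x)).+1 = seq_min (entries y))
  \/ (m = Dec x y /\ seq_min (entries x) = (seq_max (entries y)).+1).
Proof.
rewrite /merge_melds; case: ifP => // _; case: eqP => [e [<-]|_]; first by left.
by case: eqP => // e [<-]; right.
Qed.

Lemma entries_merge x y m :
  merge_melds x y = Some m -> entries m = entries x ++ entries y.
Proof. by move=> /merge_meldsP[] [-> _]. Qed.

Lemma well_formed_merge x y m :
  well_formed x -> well_formed y -> merge_melds x y = Some m -> well_formed m.
Proof.
move=> wx wy; have [lx hx] := well_formed_interval wx.
have [ly hy] := well_formed_interval wy.
have sx := size_entries x; have sy := size_entries y.
case/merge_meldsP=> -[-> e] /=; split=> //.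
  exists lx => //; move: e; rewrite (seq_max_interval sx hx).
  by rewrite (seq_min_interval sy hy) => ->.
exists ly => //; move: e; rewrite (seq_max_interval sy hy).
by rewrite (seq_min_interval sx hx) => <-.
Qed.

(** As [v.+1] is not in [x] and [v] not in [y], the values of [x] end at [v] and those of [y] start
    at [v.+1]. Both orders are recorded, since [x] may stand on either side of [y]. *)
Lemma merge_touching x y v :
  well_formed x -> well_formed y -> uniq (entries x ++ entries y) ->
  v \in entries x -> v.+1 \in entries y ->
  merge_melds x y <> None /\ merge_melds y x <> None.
Proof.
move=> wx wy u vx vy; have [lx hx] := well_formed_interval wx.
have [ly hy] := well_formed_interval wy.
move: u; rewrite cat_uniq => /and3P[_ /hasPn /= dis _].
have := dis _ vy; have : v \notin entries y.
  by apply: contraL vx => /dis.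
move: vx vy; rewrite !(mem_interval _ hx) !(mem_interval _ hy) => *.
have e : ly = lx + size (entries x) by lia.
by rewrite e in hy; rewrite (merge_inc hx hy) (merge_dec hx hy).
Qed.

(** * Left bracketing as an iteration with an invariant *)

Definition word (ms : seq meld) : seq nat := flatten (map entries ms).

Definition bracket_step (ms : seq meld) : seq meld :=
  odflt ms (merge_leftmost ms).

(** For a suffix of a state this says that bracketing its letters alone passes through that suffix;
    for a single meld, that the meld is the left bracketing of its word. *)
Definition bracket_reachable (ms : seq meld) : Prop :=
  exists k, iter k bracket_step (map Single (word ms)) = ms.

Lemma word_single w : word (map Single w) = w.
Proof. by rewrite /word -map_comp; elim: w => //= a w ->. Qed.

Lemma merge_leftmost_cons x y t :
  merge_leftmost [:: x, y & t] =
    if merge_melds x y is Some m then Some (m :: t)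
    else omap (cons x) (merge_leftmost (y :: t)).
Proof. by []. Qed.

Lemma word_merge ms ms' : merge_leftmost ms = Some ms' -> word ms' = word ms.
Proof.
elim: ms ms' => // x [|y t] ih ms' //; rewrite merge_leftmost_cons.
case E: (merge_melds x y) => [m|].
  by case=> <-; rewrite /word /= (entries_merge E) -catA.
case E': (merge_leftmost _) => [t'|] // [<-].
by have := ih _ E'; rewrite /word /= => ->.
Qed.

Lemma size_merge ms ms' :
  merge_leftmost ms = Some ms' -> size ms = (size ms').+1.
Proof.
elim: ms ms' => // x [|y t] ih ms' //; rewrite merge_leftmost_cons.
case E: (merge_melds x y) => [m|]; first by case=> <-.
by case E': (merge_leftmost _) => [t'|] // [<-] /=; have /= -> := ih _ E'.
Qed.

Definition is_single (m : meld) : bool := if m is Single _ then true else false.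

(** Trace of the leftmost rule: a merger just right of [x] could be formed only because [x] did not
    merge with its left child. *)
Definition left_child_unmergeable (x y : meld) : Prop :=
  match y with
  | Single _ => True
  | Inc a _ | Dec a _ => merge_melds x a = None
  end.

(* Left bracketing works as a stack machine: the melds to the right of the
   leftmost mergeable pair are still unread letters. *)
Fixpoint stack_state (ms : seq meld) : Prop :=
  match ms with
  | x :: t =>
      [/\ well_formed x, bracket_reachable ms,
          if t is y :: t' then
            (merge_melds x y = None \/ all is_single t')
            /\ left_child_unmergeable x y
          else True
        & stack_state t]
  | [::] => True
  end.

Lemma stack_state_single w : stack_state (map Single w).
Proof.
elim: w => //= a w ih; split=> //.
  by exists 0; rewrite -[Single a :: _]/(map Single (a :: w)) word_single.
case: w {ih} => //= b w; split=> //; right.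
by elim: w.
Qed.

Lemma bracket_reachable_step ms ms' :
  bracket_reachable ms -> merge_leftmost ms = Some ms' -> bracket_reachable ms'.
Proof.
move=> [k hk] e; exists k.+1; rewrite (word_merge e) iterS hk.
by rewrite /bracket_step e.
Qed.

(** A merge of the first two melds has only unread letters to its right, where the conditions are
    trivial. A later merge is also the leftmost one of the tail, so the tail keeps the invariant by
    induction. *)
Lemma stack_state_merge ms ms' :
  stack_state ms -> merge_leftmost ms = Some ms' -> stack_state ms'.
Proof.
elim: ms ms' => // x [|y t] ih ms' //.
move=> [wx rx [hxy cxy] sy] e; have rms' := bracket_reachable_step rx e.
have [wy _ hyz st] := sy.
move: e rms'; rewrite merge_leftmost_cons.
case E: (merge_melds x y) => [m|].
  move=> [<-] rm; split=> //; first exact: well_formed_merge E.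
  case: t hxy {ih sy rx rm hyz st} => // z t [|/=]; first by rewrite E.
  move=> /andP[sz st]; split; first by right.
  by case: z sz.
case E': (merge_leftmost (y :: t)) => [t'|] // [<-] rx'.
split=> //; last exact: ih.
move: E'; case: t hyz {ih sy rx hxy st} => // z t [hyz _].
rewrite merge_leftmost_cons.
case E2: (merge_melds y z) => [m|].
  case=> <-; split; first by case: hyz; [rewrite E2 | right].
  (* The new meld has left child [y], with which [x] failed to merge. *)
  by case/merge_meldsP: E2 => -[-> _].
by case: merge_leftmost => // t2 [<-]; split=> //; left.
Qed.

Lemma stack_state_iter k w :
  stack_state (iter k bracket_step (map Single w)).
Proof.
elim: k => [|k ih] /=; first exact: stack_state_single.
rewrite {1}/bracket_step; case E: merge_leftmost => [ms|] //=.
exact: stack_state_merge E.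
Qed.

Lemma word_iter k w : word (iter k bracket_step (map Single w)) = w.
Proof.
elim: k => [|k ih] /=; first exact: word_single.
rewrite {1}/bracket_step; case E: merge_leftmost => [ms|] //=.
by rewrite (word_merge E).
Qed.

(** Each effective round shortens the list, and a list without mergeable pair is a fixed point. *)
Lemma iter_bracket_final k ms :
  size ms <= k -> merge_leftmost (iter k bracket_step ms) = None.
Proof.
elim: k ms => [|k ih] ms hk; first by case: ms hk.
rewrite iterSr; case E: (merge_leftmost ms) => [ms'|].
  rewrite {2}/bracket_step E; apply: ih.
  by move: hk; rewrite (size_merge E).
have fix_ms : bracket_step ms = ms by rewrite /bracket_step E.
by rewrite fix_ms iter_fix.
Qed.

Lemma left_bracketingE w :
  left_bracketing w = iter (size w) bracket_step (map Single w).
Proof. by []. Qed.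

(** A single meld is a fixed point, and so is the state in which [left_bracketing] stops; after
    enough rounds the two coincide. *)
Lemma left_bracketing_reachable m :
  bracket_reachable [:: m] -> left_bracketing (entries m) = [:: m].
Proof.
rewrite /bracket_reachable /word /= cats0 => -[k hk].
set w := entries m in hk *.
have e : iter (k + size w) bracket_step (map Single w) = [:: m].
  by rewrite addnC iterD hk iter_fix.
rewrite -e left_bracketingE iterD.
have := @iter_bracket_final (size w) (map Single w).
rewrite size_map => /(_ (leqnn _)).
move: (iter _ _ _) => ms hms.
by rewrite iter_fix // /bracket_step hms.
Qed.

(** Going back past idle rounds, the round that produced [M] shortened its list by one, hence
    started from a pair. *)
Lemma last_merge k ms M :
  iter k bracket_step ms = [:: M] -> 1 < size ms ->
  exists k' x y, iter k' bracket_step ms = [:: x; y] /\ merge_melds x y = Some M.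
Proof.
elim: k => [/= ->|k ih] //=.
rewrite {1}/bracket_step; case E: merge_leftmost => [ms'|] /=; last exact: ih.
move=> e _; rewrite {}e in E; exists k; have := size_merge E; move: E.
case: (iter k _ _) => [|x [|y [|z t]]] //=.
by case E: merge_melds => [m|] // [<-] _; exists x, y.
Qed.

(** * Reduced forms and indecomposability of interval words *)

(** Replaces sorting by counting, which is additive over concatenation and blind to the order of
    letters. *)
Lemma index_sort_leq w x :
  uniq w -> x \in w -> index x (sort leq w) = count (fun y => y < x) w.
Proof.
move=> uw xw; have srt := sort_sorted leq_total w.
have ps : perm_eq (sort leq w) w by rewrite perm_sort.
rewrite -(seq.permP ps); have us : uniq (sort leq w) by rewrite sort_uniq.
have : x \in sort leq w by rewrite mem_sort.
elim: (sort leq w) srt us {ps} => //= a s ih pas /andP[as_ us].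
have la : all (leq a) s by apply: order_path_min pas; apply: leq_trans.
rewrite inE eq_sym; case: (eqVneq a x) => [e _|ne /= xs].
  rewrite -e ltnn; symmetry; apply/eqP; rewrite -leqn0 leqNgt -has_count.
  by apply/hasPn => y /(allP la); rewrite -leqNgt.
by rewrite (ltn_neqAle a) ne (allP la _ xs) ih // (path_sorted pas).
Qed.

Lemma count_ltn_interval lo s x :
  interval lo s -> x \in s -> count (fun y => y < x) s = x - lo.
Proof.
move=> h; rewrite (mem_interval _ h) (seq.permP h) => /andP[lox hix].
have -> : size s = (x - lo) + (size s - (x - lo)) by lia.
rewrite iotaD count_cat.
rewrite (@eq_in_count _ _ predT); last by move=> y; rewrite mem_iota /=; lia.
rewrite (@eq_in_count _ _ pred0 (iota (lo + _) _)); last first.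
  by move=> y; rewrite mem_iota /=; lia.
by rewrite count_predT count_pred0 size_iota addn0.
Qed.

(** The letters of [t] exceed those of [s], so they do not affect the ranks of the latter. *)
Lemma reduced_form_cat lo s t :
  interval lo s -> uniq (s ++ t) -> all (leq (lo + size s)) t ->
  take (size s) (reduced_form (s ++ t)) = [seq (x - lo).+1 | x <- s].
Proof.
move=> h u /allP tge; rewrite /reduced_form map_cat take_size_cat ?size_map //.
apply/eq_in_map => x xs; rewrite index_sort_leq ?mem_cat ?xs //.
rewrite count_cat (count_ltn_interval h xs).
rewrite (@eq_in_count _ _ pred0 t) ?count_pred0 ?addn0 // => y /tge /=.
by move: xs; rewrite (mem_interval _ h); lia.
Qed.

Lemma reduced_form_interval lo s :
  interval lo s -> reduced_form s = [seq (x - lo).+1 | x <- s].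
Proof.
move=> h; rewrite -(@reduced_form_cat lo s [::]) ?cats0 //.
  by rewrite take_oversize // size_map.
exact: interval_uniq h.
Qed.

(** Constraining [f] only from [lo] on admits truncated subtraction. *)
Lemma map_iota_shift f lo lo' k :
  (forall i, f (lo + i) = lo' + i) -> map f (iota lo k) = iota lo' k.
Proof.
elim: k lo lo' => //= k ih lo lo' hf.
have -> : f lo = lo' by have := hf 0; rewrite !addn0.
by congr (_ :: _); apply: ih => i; rewrite !addSnnS.
Qed.

Lemma interval_shift lo s : interval lo s -> interval 1 [seq (x - lo).+1 | x <- s].
Proof.
move=> h; rewrite /interval size_map; have := perm_map (fun x => (x - lo).+1) h.
by rewrite (@map_iota_shift _ lo 1) // => i; lia.
Qed.

(** The lower bound makes the truncated shift invertible on [s]. *)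
Lemma interval_unshift lo s :
  all (leq lo) s -> interval 1 [seq (x - lo).+1 | x <- s] -> interval lo s.
Proof.
move=> /allP ge; rewrite /interval size_map.
move/(perm_map (fun x => x.-1 + lo)); rewrite -map_comp.
have can : {in s, (fun x => x.-1 + lo) \o (fun x => (x - lo).+1) =1 id}.
  by move=> x /ge /= lx; lia.
rewrite (map_id_in can).
by rewrite (@map_iota_shift _ 1 lo) // => i; lia.
Qed.

(** Indecomposability without passing to the reduced form, for a word whose values form an interval
    from [lo]. *)
Definition unsplittable (lo : nat) (s : seq nat) : Prop :=
  forall j, 0 < j < size s -> ~~ interval lo (take j s).

Lemma interval_ge lo s : interval lo s -> all (leq lo) s.
Proof. by move=> h; apply/allP => x; rewrite (mem_interval _ h) => /andP[]. Qed.

Lemma indecomposable_unsplittable lo s :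
  interval lo s -> unsplittable lo s -> indecomposable s.
Proof.
move=> h uns; apply/allP => j; rewrite mem_iota /reduced_form size_map.
move: j => /= j hj.
have js : j < size s by lia.
rewrite -/(reduced_form s) (reduced_form_interval h) -map_take.
apply: contra (uns j _); last by lia.
move=> hp; apply: interval_unshift; first by apply/allP => x /mem_take /(allP (interval_ge h)).
by rewrite /interval size_map size_takel //; lia.
Qed.

(** The letters of [t] may leave gaps, so this applies to arbitrary prefixes of an interval word. *)
Lemma not_indecomposable_cat lo s t :
  0 < size s -> 0 < size t ->
  interval lo s -> uniq (s ++ t) -> all (leq (lo + size s)) t ->
  ~~ indecomposable (s ++ t).
Proof.
move=> s0 t0 h u tge; apply/allPn; exists (size s).
  by rewrite mem_iota size_map size_cat /=; lia.
rewrite negbK (reduced_form_cat h) //.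
by have := interval_shift h; rewrite /interval size_map.
Qed.

(** * Indecomposable components and unsplittable words *)

Lemma longest_indec_prefix_sizeP w k :
  0 < k <= size w -> indecomposable (take k w) ->
  (forall j, k < j <= size w -> ~~ indecomposable (take j w)) ->
  longest_indec_prefix_size w = k.
Proof.
move=> hk ik hj; apply: seq_maxP => [|y].
  by rewrite mem_filter ik mem_iota; lia.
rewrite mem_filter mem_iota => /andP[iy hy]; rewrite leqNgt; apply/negP => ky.
by have := hj y; rewrite iy; lia.
Qed.

(** The longest indecomposable prefix is the shortest nonempty prefix that is an interval from [lo]:
    minimality makes that prefix unsplittable, and every longer prefix splits after it. *)
Lemma longest_indec_prefix_size_split lo w :
  0 < size w -> interval lo w ->
  let k := longest_indec_prefix_size w in
  [/\ 0 < k <= size w, interval lo (take k w)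
    & forall j, 0 < j -> interval lo (take j w) -> k <= j].
Proof.
move=> w0 hw /=.
have ex : exists j, (0 < j <= size w) && interval lo (take j w).
  by exists (size w); rewrite w0 leqnn take_size.
case: (ex_minnP ex) => k /andP[hk ik] kmin.
have -> : longest_indec_prefix_size w = k.
  apply: longest_indec_prefix_sizeP => //.
    apply: indecomposable_unsplittable ik _ => j; rewrite size_takel; last by lia.
    move=> hj; apply/negP => hi; have := kmin j.
    by move: hi; rewrite take_takel; [move=> ->; lia | lia].
  move=> j hj; have e : take k w ++ drop k (take j w) = take j w.
    by rewrite -[RHS](cat_take_drop k) take_takel //; lia.
  rewrite -e; apply: (not_indecomposable_cat _ _ ik).
  - by rewrite size_takel; lia.
  - by rewrite size_drop size_takel; lia.
  - by rewrite e take_uniq // (interval_uniq hw).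
  have hd := hw; rewrite -(cat_take_drop k w) in hd.
  have hdrop := interval_ge (interval_suffix hd ik).
  apply/allP => x; rewrite -{1}(subnK (_ : k <= j)); last by lia.
  rewrite -take_drop => /mem_take xd.
  exact: (allP hdrop).
split=> // j j0 hj; case: (leqP j (size w)) => [jw|]; last by lia.
by apply: kmin; rewrite hj; lia.
Qed.

Lemma components_unsplittable fuel lo s :
  0 < size s -> interval lo s -> unsplittable lo s ->
  components_rec fuel.+1 s = [:: s].
Proof.
move=> s0 h uns; have [hk ik _] := longest_indec_prefix_size_split s0 h.
have e : longest_indec_prefix_size s = size s.
  apply/eqP; rewrite eqn_leq; apply/andP; split; first by lia.
  by rewrite leqNgt; apply: contraL ik => lt; apply: uns; lia.
rewrite [components_rec _ _]/=; case: s s0 e {h uns hk ik} => // a s _ ->.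
by rewrite take_size drop_size; case: fuel.
Qed.

(** As [s] is itself an interval prefix, the first component ends within [s], and what is left of
    [s] is again an interval. Once [s] is used up, [t] is a single component; the strict fuel bound
    reserves a round for it. *)
Lemma last_components fuel lo s t :
  size s < fuel -> 0 < size t ->
  interval lo s -> interval (lo + size s) t -> unsplittable (lo + size s) t ->
  last [::] (components_rec fuel (s ++ t)) = t.
Proof.
elim: fuel lo s => // fuel ih lo s hf t0 hs ht uns.
have [s0|s0] := posnP (size s).
  rewrite (size0nil s0) cat0s in ht uns *; rewrite addn0 in ht uns.
  by rewrite (components_unsplittable _ t0 ht uns).
have hst := interval_cat hs ht.
have st0 : 0 < size (s ++ t) by rewrite size_cat; lia.
have [hk ik kmin] := longest_indec_prefix_size_split st0 hst.
have ks := kmin (size s) s0; rewrite take_size_cat // in ks.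
move: (ks hs) hk ik {kmin}; set k := longest_indec_prefix_size _ => {}ks hk ik.
have -> : components_rec fuel.+1 (s ++ t)
    = take k (s ++ t) :: components_rec fuel (drop k (s ++ t)).
  by rewrite /k; case: (s ++ t) st0.
have ed : drop k (s ++ t) = drop k s ++ t.
  rewrite drop_cat; case: ltnP => // sk.
  have -> : k = size s by apply/eqP; rewrite eqn_leq ks.
  by rewrite subnn drop0 drop_size.
have et : take k (s ++ t) = take k s by rewrite takel_cat.
rewrite ed /=.
have il : drop k s ++ t = [::] -> False.
  by move/(congr1 size); rewrite size_cat /=; lia.
have hd : interval (lo + k) (drop k s).
  have := @interval_suffix lo (take k s) (drop k s).
  rewrite cat_take_drop size_takel // => /(_ hs); apply.
  by rewrite -et.
have ek : lo + k + size (drop k s) = lo + size s by rewrite size_drop; lia.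
have sf : size (drop k s) < fuel by rewrite size_drop; lia.
have := ih (lo + k) (drop k s) sf t0 hd; rewrite ek => /(_ ht uns).
(* Fuel and letters remain, so the list of later components is nonempty and the default of [last] is
   irrelevant. *)
case: fuel {ih hf} sf => // fuel _.
by move: il; rewrite [components_rec _ _]/=; case: (drop k s ++ t) => [/(_ erefl)|].
Qed.

Lemma unsplittable_dec lo a b :
  well_formed (Dec a b) -> interval lo (entries (Dec a b)) ->
  unsplittable lo (entries (Dec a b)).
Proof.
move=> [wa wb [l hb ha]] h j hj; apply/negP => hi.
have a0 := size_entries a; have b0 := size_entries b.
have el : lo = l.
  apply: interval_lo h (interval_catC (interval_cat hb ha)).
  exact: size_entries (Dec a b).
move: hj hi => /=; rewrite -{}el in hb ha *; rewrite size_cat => hj hi.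
have st : size (take j (entries a ++ entries b)) = j.
  by rewrite size_takel // size_cat; lia.
have mi x := mem_interval x hi; rewrite st in mi.
(* The value [lo] belongs to [b], so the prefix must reach beyond [a]. *)
have ja : size (entries a) < j.
  rewrite ltnNge; apply/negP => ja; have := mi lo.
  rewrite takel_cat // leqnn -[X in X < _]addn0 ltn_add2l.
  case/andP: hj => -> _ /mem_take; rewrite (mem_interval _ ha); lia.
(* This is the maximum of the whole word; it lies in [a], hence in the prefix, whose [j] values from
   [lo] on stop short of it. *)
have := mi (lo + size (entries b) + (size (entries a)).-1).
rewrite take_cat ltnNge (ltnW ja) /= mem_cat (mem_interval _ ha); lia.
Qed.

(** * Indices of the blocks of a state *)

Definition block (ms : seq meld) (a : nat) : nat :=
  find (fun m => a \in entries m) ms.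

Arguments block : simpl never.

Lemma word_cons m ms : word (m :: ms) = entries m ++ word ms.
Proof. by []. Qed.

Lemma mem_word ms a : (a \in word ms) = has (fun m => a \in entries m) ms.
Proof. by elim: ms => //= m ms ih; rewrite /word /= mem_cat ih. Qed.

(** Membership excludes the default [size ms], which [find] returns for a value in no block. *)
Lemma block_lt ms a : a \in word ms -> block ms a < size ms.
Proof. by rewrite mem_word has_find. Qed.

Lemma mem_nth_block ms a :
  a \in word ms -> a \in entries (nth (Single 0) ms (block ms a)).
Proof.
move=> /block_lt; rewrite -has_find.
exact: (nth_find (Single 0) (a := fun m => a \in entries m)).
Qed.

Lemma mem_nth_word ms k a :
  k < size ms -> a \in entries (nth (Single 0) ms k) -> a \in word ms.
Proof.
by move=> kms ak; rewrite mem_word; apply/(has_nthP (Single 0)); exists k.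
Qed.

Lemma block_cons m ms a : uniq (word (m :: ms)) ->
  a \in word ms -> block (m :: ms) a = (block ms a).+1.
Proof.
rewrite /word /= cat_uniq => /and3P[_ /hasPn/= dis _] ams.
by rewrite /block /= (negPf (dis _ ams)).
Qed.

Lemma block_nth ms k a : uniq (word ms) -> k < size ms ->
  a \in entries (nth (Single 0) ms k) -> block ms a = k.
Proof.
elim: ms k => // m ms ih [|k] u; first by rewrite /block /= => _ ->.
move=> kms ak; rewrite (block_cons u (@mem_nth_word ms k a kms ak)) (ih k) //.
by move: u; rewrite /word /= cat_uniq => /and3P[].
Qed.

(** Blocks fill consecutive positions and none is empty, so the index cannot skip one. *)
Lemma block_step ms j : uniq (word ms) -> j.+1 < size (word ms) ->
  let f i := block ms (nth 0 (word ms) i) in f j.+1 = f j \/ f j.+1 = (f j).+1.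
Proof.
elim: ms j => // m ms ih j u hj /=.
have uw : uniq (word ms).
  by move: u; rewrite /word /= cat_uniq => /and3P[].
have lo i : i < size (entries m) -> block (m :: ms) (nth 0 (word (m :: ms)) i) = 0.
  by move=> hi; rewrite /word /= nth_cat hi /block /= mem_nth.
have hi i : size (entries m) <= i -> i < size (word (m :: ms)) ->
    block (m :: ms) (nth 0 (word (m :: ms)) i)
    = (block ms (nth 0 (word ms) (i - size (entries m)))).+1.
  move=> hm; rewrite word_cons size_cat => hi.
  rewrite nth_cat ltnNge hm /= block_cons //.
  by apply: mem_nth; move: hi => /=; lia.
case: (ltngtP j.+1 (size (entries m))) => jm.
- by left; rewrite !lo //; lia.
- rewrite !hi //; try lia.
  rewrite subSn; last by lia.
  have hj' : (j - size (entries m)).+1 < size (word ms).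
    by move: hj; rewrite word_cons size_cat; lia.
  by have [->|->] := ih _ uw hj'; [left|right].
- right; rewrite (lo j) -?jm // (hi j.+1) -?jm // subnn.
  case: ms {ih u lo hi} hj uw => [|x t] hj _.
    by move: hj; rewrite /word /= cats0 -jm ltnn.
  by rewrite /block /word /=; case: (entries x) (size_entries x) => //= b s _; rewrite mem_head.
Qed.

Lemma merge_leftmost_none ms k :
  merge_leftmost ms = None -> k.+1 < size ms ->
  merge_melds (nth (Single 0) ms k) (nth (Single 0) ms k.+1) = None.
Proof.
elim: ms k => // x [|y t] ih k //; rewrite merge_leftmost_cons.
case E: merge_melds => [//|]; case E': merge_leftmost => [//|] _.
by case: k => //= k; apply: ih.
Qed.

Lemma stack_state_well_formed ms k :
  stack_state ms -> well_formed (nth (Single 0) ms k).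
Proof.
elim: ms k => [|x ms ih] [|k] //=; first by case.
by case=> _ _ _ /ih.
Qed.

Lemma uniq_word_nth ms k : uniq (word ms) -> k.+1 < size ms ->
  uniq (entries (nth (Single 0) ms k) ++ entries (nth (Single 0) ms k.+1)).
Proof.
elim: ms k => // x ms ih [|k]; rewrite [word _]/=.
  case: ms {ih} => // y ms; rewrite /word /= catA cat_uniq.
  by move=> /and3P[].
by rewrite cat_uniq => /and3P[_ _ u] /= h; apply: ih.
Qed.

Section IrreducibleState.
Variable ms : seq meld.
Hypotheses (wf_ms : forall k, well_formed (nth (Single 0) ms k))
  (uniq_ms : uniq (word ms)) (irr_ms : merge_leftmost ms = None).

(** Distance two suffices, as the two vertical neighbours of a cell are two rows apart. *)
Lemma block_convex v : v \in word ms -> v.+2 \in word ms ->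
  block ms v = block ms v.+2 -> block ms v.+1 = block ms v.
Proof.
move=> hv hv2 e; apply: block_nth; rewrite ?block_lt //.
have := mem_nth_block hv2; have := mem_nth_block hv; rewrite -e.
have [lo h] := well_formed_interval (wf_ms (block ms v)).
by rewrite !(mem_interval _ h); lia.
Qed.

(** Neighbouring blocks holding [v] and [v.+1] would be mergeable, whichever comes first. *)
Lemma block_not_touching v : v \in word ms -> v.+1 \in word ms ->
  block ms v.+1 <> (block ms v).+1 /\ block ms v <> (block ms v.+1).+1.
Proof.
move=> hv hv1.
have bv := mem_nth_block hv; have bv1 := mem_nth_block hv1.
have lv := block_lt hv; have lv1 := block_lt hv1.
split=> e; rewrite e in lv lv1 bv bv1.
  have u := uniq_word_nth uniq_ms lv1.
  have [h _] := merge_touching (wf_ms _) (wf_ms _) u bv bv1.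
  exact/h/merge_leftmost_none.
have u := uniq_word_nth uniq_ms lv; rewrite uniq_catC in u.
have [_ h] := merge_touching (wf_ms _) (wf_ms _) u bv bv1.
exact/h/merge_leftmost_none.
Qed.

End IrreducibleState.

(** * Percolation confined to blocks *)

Lemma size_one_line n (p : 'S_n) : size (one_line p) = n.
Proof. by rewrite size_map size_enum_ord. Qed.

Lemma nth_one_line n (p : 'S_n) (j : 'I_n) : nth 0 (one_line p) j = (p j).+1.
Proof. by rewrite (nth_map j) ?size_enum_ord // nth_ord_enum. Qed.

Lemma interval_one_line n (p : 'S_n) : interval 1 (one_line p).
Proof.
rewrite /interval size_one_line -[1]addn0 (iotaDl 1) -val_enum_ord -map_comp.
have -> : one_line p = [seq (val j).+1 | j <- map p (enum 'I_n)].
  by rewrite -map_comp.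
apply: perm_map; apply: uniq_perm; rewrite ?(map_inj_uniq (@perm_inj _ p)) ?enum_uniq //.
move=> j; rewrite mem_enum; apply/mapP; exists ((p^-1)%g j).
  by rewrite mem_enum.
by rewrite permKV.
Qed.

(* [f] and [g] send a column and a row to the index of the block that meets it.
   A cell outside all blocks can have infected neighbours only in the block of
   its column and the block of its row; by convexity it takes one of each to
   infect it, and then these two blocks touch. *)
Lemma blocks_closed n (f g : nat -> nat) (A : 'M[bool]_n) (c : 'I_n * 'I_n) :
  (forall j, j.+1 < n -> f j.+1 = f j \/ f j.+1 = (f j).+1) ->
  (forall i, i.+2 < n -> g i = g i.+2 -> g i.+1 = g i) ->
  (forall i, i.+1 < n -> g i.+1 <> (g i).+1 /\ g i <> (g i.+1).+1) ->
  (forall i j : 'I_n, A i j -> f j = g i) ->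
  mutable A c -> f c.2 = g c.1.
Proof.
move=> hf hg ht hA /andP[_]; case: c => i j /card_gt1P[[i1 j1] [[i2 j2]]].
rewrite !inE /orth_neighbour /= => -[/andP[n1 /hA a1] /andP[n2 /hA a2] ne].
have {}ne : i1 <> i2 :> nat \/ j1 <> j2 :> nat.
  have [e|] := eqVneq (i1 : nat) i2; last by left; apply/eqP.
  right=> e'; case/eqP: ne; congr (_, _); exact: val_inj.
have N (x y : 'I_n) : (x == y) = (x == y :> nat) by [].
rewrite !N in n1 n2 => {N hA}.
case: i j i1 j1 i2 j2 n1 n2 a1 a2 ne => [i hi] [j hj] [i1 hi1] [j1 hj1] [i2 hi2] [j2 hj2] /=.
have horiz x : (j.+1 == x) || (x.+1 == j) -> x < n ->
    x = j.+1 /\ (f x = f j \/ f x = (f j).+1)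
    \/ j = x.+1 /\ (f j = f x \/ f j = (f x).+1).
  by case/orP=> /eqP e hx; subst; [left|right]; split=> //; apply: hf.
have vert x : (i.+1 == x) || (x.+1 == i) -> x < n ->
    (x = i.+1 \/ i = x.+1) /\ g x <> (g i).+1 /\ g i <> (g x).+1.
  case/orP=> /eqP e hx; subst; (split; first by [left|right]).
    exact: ht.
  by have [] := ht _ hi.
have convex x y : x = i.+1 -> i = y.+1 -> x < n -> g y = g x -> g i = g y.
  by move=> -> ->; apply: hg.
(* Two horizontal neighbours: [f] is monotone, so [f j] is squeezed. One of each kind: the
   horizontal one bounds the difference of [f j] and [g i] by one, the vertical one excludes exactly
   one. Two vertical neighbours: convexity. *)
move=> /orP[] /andP[/eqP e1 n1] /orP[] /andP[/eqP e2 n2] a1 a2 ne; subst.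
- by case: (horiz _ n1 hj1) (horiz _ n2 hj2); clear -a1 a2 ne; lia.
- by case: (horiz _ n1 hj1) (vert _ n2 hi2); clear -a1 a2; lia.
- by case: (vert _ n1 hi1) (horiz _ n2 hj2); clear -a1 a2; lia.
have [[e1|e1] _] := vert _ n1 hi1; have [[e2|e2] _] := vert _ n2 hi2.
- by lia.
- by rewrite (convex _ _ e1 e2 hi1) // -a1.
- by rewrite (convex _ _ e2 e1 hi2) // -a2.
- by lia.
Qed.

Lemma full_left_bracketing n (p : 'S_n) : 0 < n -> full p ->
  exists M, left_bracketing (one_line p) = [:: M].
Proof.
move=> n0 /andP[conn _]; rewrite left_bracketingE; set w := one_line p.
set ms := iter _ _ _.
have wms : word ms = w by apply: word_iter.
have irr : merge_leftmost ms = None.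
  by apply: iter_bracket_final; rewrite size_map.
have wf k : well_formed (nth (Single 0) ms k).
  exact/stack_state_well_formed/stack_state_iter.
have iw : interval 1 w by apply: interval_one_line.
have sw : size w = n by apply: size_one_line.
have mw a : (a \in word ms) = (0 < a <= n).
  by rewrite wms (mem_interval _ iw) sw; lia.
have u : uniq (word ms) by rewrite wms (interval_uniq iw).
(* The 0-based row [i] carries the value [n - i]. *)
pose f j := block ms (nth 0 w j); pose g i := block ms (n - i).
have hf j : j.+1 < n -> f j.+1 = f j \/ f j.+1 = (f j).+1.
  by move=> hj; have := block_step u (j := j); rewrite wms sw => /(_ hj).
have hg i : i.+2 < n -> g i = g i.+2 -> g i.+1 = g i.
  move=> hi e; rewrite e /g (_ : n - i.+1 = (n - i.+2).+1); last by lia.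
  apply: block_convex; rewrite ?mw //; try lia.
  by rewrite (_ : (n - i.+2).+2 = n - i) //; lia.
have ht i : i.+1 < n -> g i.+1 <> (g i).+1 /\ g i <> (g i.+1).+1.
  move=> hi; rewrite /g (_ : n - i = (n - i.+1).+1); last by lia.
  by have [] := @block_not_touching ms wf u irr (n - i.+1); rewrite ?mw; lia.
have inv A B : connect (@bootstrap_step n) A B ->
    (forall i j : 'I_n, A i j -> f j = g i) ->
    (forall i j : 'I_n, B i j -> f j = g i).
  case/connectP=> s; elim: s A => [|C s ih] A /= => [_ -> //|].
  move=> /andP[/existsP[c /andP[mc /eqP eC]] ps] eB hA.
  apply: ih ps eB _ => i j; rewrite eC mxE => /orP[/eqP e|]; last exact: hA.
  by have := blocks_closed hf hg ht hA mc; rewrite -e.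
(* The all-ones matrix inherits the invariant, so all rows and columns meet the same block. *)
have all_eq (i j : 'I_n) : f j = g i.
  apply: (inv _ _ conn); last by rewrite mxE.
  move=> {}i {}j; rewrite mxE => /eqP ->; rewrite /f /g nth_one_line /=.
  by congr (block ms _); have := ltn_ord (p j); lia.
case Ems: ms wms => [|M [|M' t]] wms; last 1 first.
(* With a second block, some value would have index 1 and another index 0. *)
- have lt1 : 1 < size ms by rewrite Ems.
  have [a ha] : exists a, a \in entries (nth (Single 0) ms 1).
    case: (entries _) (size_entries (nth (Single 0) ms 1)) => // a s _.
    by exists a; rewrite mem_head.
  have [b hb] : exists b, b \in entries (nth (Single 0) ms 0).
    case: (entries _) (size_entries (nth (Single 0) ms 0)) => // b s _.
    by exists b; rewrite mem_head.
  have ba := block_nth u lt1 ha; have bb := block_nth u (ltnW lt1) hb.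
  have := mem_nth_word lt1 ha; have := mem_nth_word (ltnW lt1) hb.
  rewrite !mw => hb' ha'.
  have e v : 0 < v <= n -> block ms v = f 0.
    move=> hv; have vn : n - v < n by lia.
    rewrite (all_eq (Ordinal vn) (Ordinal n0)) /g /=.
    by congr (block ms _); lia.
  by move: ba bb; rewrite !e // => ->.
- by move: sw; rewrite -wms /word /=; lia.
- by exists M.
Qed.

Theorem theorem4p8 (n : nat) (p : 'S_n) (hn : 2 <= n) (hp : full p) :
  exists M : meld,
    [/\ left_bracketing (one_line p) = [:: M],
        (exists m1 m2 : meld, M = Dec m1 m2) ->
          indecomposable_perm (one_line p)
          /\ components (one_line p) = [:: one_line p]
      & ~ (exists m1 m2 : meld, M = Dec m1 m2) ->
          ~~ indecomposable_perm (one_line p)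
          /\ exists m1 m2 : meld,
               [/\ M = Inc m1 m2,
                   entries m2 = last [::] (components (one_line p))
                 & left_bracketing (entries m2) = [:: m2]]].
Proof.
have [M hM] := full_left_bracketing (ltnW hn) hp; exists M.
have iw := interval_one_line p; have sw := size_one_line p.
have wM : entries M = one_line p.
  have := word_iter (size (one_line p)) (one_line p).
  by rewrite -left_bracketingE hM /word /= cats0.
move: (hM); rewrite left_bracketingE => hM'.
(* The state just before the last merge is kept, since its invariant tells how [y] arose. *)
have [|k [x [y [exy mxy]]]] := last_merge hM'; first by rewrite size_map sw.
have := stack_state_iter (size (one_line p)) (one_line p).
rewrite hM' => -[wfM _ _ _].
split=> // [[m1 [m2 eM]]|nD].
  have uns : unsplittable 1 (one_line p).
    by rewrite -wM eM; apply: unsplittable_dec; rewrite -eM ?wM.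
  split.
    apply/allP => j; rewrite mem_iota /= => hj.
    have := uns j; rewrite /interval size_takel; last by lia.
    by apply; lia.
  rewrite /components -[X in components_rec X](ltn_predK (m := 0)) ?sw; last by lia.
  by apply: components_unsplittable uns; rewrite ?sw //; lia.
(* Here [cxy] says that [x] did not merge with the left child of [y], and [ry] that the letters of
   [y] alone bracket to [y]. *)
have := stack_state_iter k (one_line p).
rewrite exy => -[_ _ [_ cxy] [wfy ry _ _]].
have eM : M = Inc x y.
  by case/merge_meldsP: mxy => -[e _] //; case: nD; exists x, y.
rewrite eM in wfM wM; have [_ _ [lo hx hy]] := wfM.
have x0 := size_entries x; have y0 := size_entries y.
have hlo : lo = 1.
  apply: (interval_lo (size_entries (Inc x y)) (interval_cat hx hy)).
  by rewrite wM.
subst lo; rewrite -wM; split.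
  (* The letters of [x] are exactly the values from 1 to their number. *)
  apply/allPn; exists (size (entries x)).
    by rewrite mem_iota /= size_cat; lia.
  by rewrite /= take_size_cat // negbK.
exists x, y; split=> //; last exact: left_bracketing_reachable.
symmetry; apply: (last_components _ _ hx hy) => //; first by rewrite /= size_cat; lia.
case: y {wM mxy eM exy wfM} hy y0 cxy wfy ry => [b|a b|a b] hy y0 cxy wfy ry.
- by move=> j /=; lia.
(* The values of [a] start right after those of [x], so [x] and [a] would be mergeable, against
   [cxy]. *)
- case: wfy => _ _ [l ha hb].
  have el := interval_lo y0 (interval_cat ha hb) hy.
  by rewrite el in ha; rewrite /= (merge_inc hx ha) in cxy.
- exact: unsplittable_dec.
Qed.
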